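(* Let $X$ be a real Banach space and let $g:X^*\to(-\infty,+\infty]$ be a proper convex weak$^*$-lower semicontinuous function such that $\operatorname{int}(\operatorname{dom} g)\ne\emptyset$ (respectively, $\operatorname{int}(\operatorname{dom}(g^*|_X))\neq\emptyset$). Then for any $x_0^*\in D(\partial g\cap X)$ and any $x^*\in\operatorname{dom} g$ (respectively, any $x^*\in X^*$), $$g(x^* )=g(x_0^* )+\sup\Big\{\sum_{i=0}^{n-1}\langle x_i,x_{i+1}^*-x_i^*\rangle+\langle x_n,x^*-x_n^*\rangle\Big\},$$ where the supremum is taken over all integers $n\ge0$, all $x_1^*,\dots,x_n^*\in X^*$ and all $x_i\in\partial g(x_i^* )\cap X$ for $i=0,1,\dots,n$.
   Context: $X$ is identified with its canonical image in $X^{**}$; for $x^*\in\operatorname{dom} g=\{g<+\infty\}$, $\partial g(x^* )\cap X=\{x\in X:\langle y^*-x^*,x\rangle\le g(y^* )-g(x^* )\ \forall y^*\in X^*\}$ (empty outside $\operatorname{dom} g$), and $D(\partial g\cap X)=\{x^*:\partial g(x^* )\cap X\ne\emptyset\}$. $g^*|_X(x)=\sup_{x^*\in X^*}(\langle x^*,x\rangle-g(x^* ))$ for $x\in X$; interiors are in the norm topologies. *)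

(* Defs.v *)
From Stdlib Require Import Reals List.
Open Scope R_scope.

Record Banach := {
  car :> Type;
  vzero : car;
  vadd : car -> car -> car;
  vopp : car -> car;
  vscal : R -> car -> car;
  vnorm : car -> R;
  vadd_assoc : forall x y z, vadd x (vadd y z) = vadd (vadd x y) z;
  vadd_comm : forall x y, vadd x y = vadd y x;
  vadd_0 : forall x, vadd x vzero = x;
  vadd_opp : forall x, vadd x (vopp x) = vzero;
  vscal_1 : forall x, vscal 1 x = x;
  vscal_assoc : forall a b x, vscal a (vscal b x) = vscal (a * b) x;
  vscal_distr_v : forall a x y, vscal a (vadd x y) = vadd (vscal a x) (vscal a y);
  vscal_distr_s : forall a b x, vscal (a + b) x = vadd (vscal a x) (vscal b x);
  vnorm_nonneg : forall x, 0 <= vnorm x;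
  vnorm_eq0 : forall x, vnorm x = 0 -> x = vzero;
  vnorm_scal : forall a x, vnorm (vscal a x) = Rabs a * vnorm x;
  vnorm_triangle : forall x y, vnorm (vadd x y) <= vnorm x + vnorm y;
  vcomplete : forall u : nat -> car,
    (forall eps, 0 < eps -> exists N, forall m n, (N <= m)%nat -> (N <= n)%nat ->
        vnorm (vadd (u m) (vopp (u n))) < eps) ->
    exists l, forall eps, 0 < eps -> exists N, forall n, (N <= n)%nat ->
        vnorm (vadd (u n) (vopp l)) < eps
}.

Record dual (X : Banach) := {
  dfun :> X -> R;
  dfun_add : forall x y, dfun (vadd X x y) = dfun x + dfun y;
  dfun_scal : forall a x, dfun (vscal X a x) = a * dfun x;
  dfun_bnd : exists C, forall x, Rabs (dfun x) <= C * vnorm X x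
}.
Arguments dfun {X}.

Inductive ER := Fin (r : R) | PInf.

Definition le_ER (a b : ER) : Prop :=
  match a, b with
  | Fin x, Fin y => x <= y
  | _, PInf => True
  | PInf, Fin _ => False
  end.

Definition lt_ER (a b : ER) : Prop :=
  match a, b with
  | Fin x, Fin y => x < y
  | Fin _, PInf => True
  | PInf, _ => False
  end.

Definition add_ER (a b : ER) : ER :=
  match a, b with
  | Fin x, Fin y => Fin (x + y)
  | _, _ => PInf
  end.

Definition is_sup_ER (S : R -> Prop) (v : ER) : Prop :=
  (forall s, S s -> le_ER (Fin s) v) /\
  (forall c, lt_ER (Fin c) v -> exists s, S s /\ c < s).

Definition in_dom {X : Banach} (g : dual X -> ER) (xs : dual X) : Prop :=
  g xs <> PInf.

Definition proper {X : Banach} (g : dual X -> ER) : Prop :=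
  exists xs, in_dom g xs.

Definition convex {X : Banach} (g : dual X -> ER) : Prop :=
  forall (x y z : dual X) (t a b : R), 0 <= t <= 1 ->
    (forall v : X, z v = t * x v + (1 - t) * y v) ->
    g x = Fin a -> g y = Fin b ->
    le_ER (g z) (Fin (t * a + (1 - t) * b)).

Definition weak_star_open {X : Banach} (U : dual X -> Prop) : Prop :=
  forall y, U y -> exists (l : list X) (eps : R), 0 < eps /\
    forall z : dual X, (forall x, In x l -> Rabs (z x - y x) < eps) -> U z.

Definition weak_star_lsc {X : Banach} (g : dual X -> ER) : Prop :=
  forall c : R, weak_star_open (fun z => lt_ER (Fin c) (g z)).

(* ||ys - xs||_{X^*} < r, with the dual (operator) norm. *)
Definition dual_dist_lt {X : Banach} (ys xs : dual X) (r : R) : Prop :=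
  exists r', r' < r /\ forall x : X, Rabs (ys x - xs x) <= r' * vnorm X x.

Definition int_dom_nonempty {X : Banach} (g : dual X -> ER) : Prop :=
  exists (x0 : dual X) (r : R), 0 < r /\
    forall y : dual X, dual_dist_lt y x0 r -> in_dom g y.

(* x \in dom (g^*|_X), i.e. sup_{x^*} (<x^*,x> - g(x^* )) < +oo. *)
Definition in_dom_conjX {X : Banach} (g : dual X -> ER) (x : X) : Prop :=
  exists M : R, forall (ys : dual X) (a : R), g ys = Fin a -> ys x - a <= M.

Definition int_dom_conjX_nonempty {X : Banach} (g : dual X -> ER) : Prop :=
  exists (x0 : X) (r : R), 0 < r /\
    forall x : X, vnorm X (vadd X x (vopp X x0)) < r -> in_dom_conjX g x.

Definition subdiffX {X : Banach} (g : dual X -> ER) (xs : dual X) (x : X) : Prop :=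
  exists a, g xs = Fin a /\
    forall (ys : dual X) (b : R), g ys = Fin b -> ys x - xs x <= b - a.

Fixpoint sumR (f : nat -> R) (n : nat) : R :=
  match n with
  | O => 0
  | S k => sumR f k + f k
  end.

Definition chain_sums {X : Banach} (g : dual X -> ER) (x0s xs : dual X) (v : R) : Prop :=
  exists (n : nat) (ps : nat -> dual X) (pts : nat -> X),
    ps O = x0s /\
    (forall i, (i <= n)%nat -> subdiffX g (ps i) (pts i)) /\
    v = sumR (fun i => ps (S i) (pts i) - ps i (pts i)) n
        + (xs (pts n) - ps n (pts n)).

(* Main.v *)
(* The function [f], the restriction to [X] of the conjugate of [g], is closed and convex; [g] is its conjugate by weak-star lower semicontinuity, and [x] lies in the subdifferential of [g] at [ys] iff [ys] lies in that of [f] at [x]. If [c < g xs], there is [xb] with [c < xs xb - f xb]. Divide the segment from [x0] to [xb] into [N] equal steps. Near each division point there is a subgradient pair of [f] (Bronsted-Rockafellar), and the increment of [f] over the next step bounds from above the value of its functional on the preceding step, so after summation by parts the chain sum telescopes to at least [xs xb - f xb - g x0s], up to [O(1/N)]. The subgradients need not be locally bounded: the pairs are chosen from [xb] backwards, each point after the functional that will act on it. *)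
Require Import Defs.
From Stdlib Require Import Reals List Lra Lia ClassicalEpsilon.
From mathcomp Require boolp classical_sets.
Open Scope R_scope.

Local Notation "x [+] y" := (vadd _ x y) (at level 50, left associativity).
Local Notation "x [-] y" := (vadd _ x (vopp _ y)) (at level 50, left associativity).
Local Notation "a [*] x" := (vscal _ a x) (at level 40, left associativity).

(** * Vector arithmetic and bounded functionals *)

Lemma vscal_0 (X : Banach) (x : X) : 0 [*] x = vzero X.
Proof. apply vnorm_eq0. rewrite vnorm_scal, Rabs_R0. ring. Qed.

Lemma vadd_cancel_l (X : Banach) (a x y : X) : a [+] x = a [+] y -> x = y.
Proof.
  intros H. rewrite <- (vadd_0 X x), <- (vadd_0 X y), <- (vadd_opp X a).
  rewrite !vadd_assoc, !(vadd_comm X _ a), H. reflexivity.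
Qed.

Lemma vopp_scal (X : Banach) (x : X) : vopp X x = (-1) [*] x.
Proof.
  apply (vadd_cancel_l X x). rewrite vadd_opp.
  rewrite <- (vscal_1 X x) at 1. rewrite <- vscal_distr_s.
  replace (1 + -1) with 0 by ring. now rewrite vscal_0.
Qed.

Lemma vadd_shuffle (X : Banach) (a b c d : X) :
  (a [+] b) [+] (c [+] d) = (a [+] c) [+] (b [+] d).
Proof.
  rewrite <- !vadd_assoc. f_equal. rewrite !vadd_assoc. f_equal. apply vadd_comm.
Qed.

Lemma vsub_add (X : Banach) (x y : X) : (x [-] y) [+] y = x.
Proof. rewrite <- vadd_assoc, (vadd_comm X _ y), vadd_opp. apply vadd_0. Qed.

Lemma vadd_sub (X : Banach) (x y : X) : (x [+] y) [-] y = x.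
Proof. rewrite <- vadd_assoc, vadd_opp. apply vadd_0. Qed.

Lemma vsub_chasles (X : Banach) (x y z : X) : (x [-] y) [+] (y [-] z) = x [-] z.
Proof. rewrite vadd_assoc, vsub_add. reflexivity. Qed.

Lemma vadd_eq_sub (X : Banach) (a b c d : X) : a [+] d = c [+] b -> a [-] b = c [-] d.
Proof.
  intros H. rewrite <- (vadd_sub X a d), H.
  rewrite <- vadd_assoc, (vadd_comm X (vopp X d)), vadd_assoc, vadd_sub. reflexivity.
Qed.

Lemma vscal_opp (X : Banach) (c : R) (x : X) : c [*] vopp X x = vopp X (c [*] x).
Proof. rewrite !vopp_scal, !vscal_assoc. f_equal. ring. Qed.

Lemma vnorm_sub_sym (X : Banach) (x y : X) : vnorm X (x [-] y) = vnorm X (y [-] x).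
Proof.
  replace (y [-] x) with ((-1) [*] (x [-] y)).
  - rewrite vnorm_scal, (Rabs_left (-1)) by lra. ring.
  - rewrite !vopp_scal, vscal_distr_v, vscal_assoc.
    replace (-1 * -1) with 1 by ring. rewrite vscal_1. apply vadd_comm.
Qed.

Lemma vnorm_zero (X : Banach) : vnorm X (vzero X) = 0.
Proof. rewrite <- (vscal_0 X (vzero X)), vnorm_scal, Rabs_R0. ring. Qed.

Lemma vnorm_sub_diag (X : Banach) (x : X) : vnorm X (x [-] x) = 0.
Proof. rewrite vadd_opp. apply vnorm_zero. Qed.

Lemma vnorm_sub_triangle (X : Banach) (x y z : X) :
  vnorm X (x [-] z) <= vnorm X (x [-] y) + vnorm X (y [-] z).
Proof. rewrite <- (vsub_chasles X x y z). apply vnorm_triangle. Qed.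

Lemma dfun_opp (X : Banach) (f : dual X) (x : X) : f (vopp X x) = - f x.
Proof. rewrite vopp_scal, dfun_scal. ring. Qed.

Lemma dfun_sub (X : Banach) (f : dual X) (x y : X) : f (x [-] y) = f x - f y.
Proof. rewrite dfun_add, dfun_opp. ring. Qed.

Lemma dual_bound (X : Banach) (f : dual X) :
  exists C, 0 <= C /\ forall x, Rabs (f x) <= C * vnorm X x.
Proof.
  destruct (dfun_bnd X f) as [C HC]. exists (Rmax C 0). split; [apply Rmax_r|].
  intros x. eapply Rle_trans; [apply HC|].
  apply Rmult_le_compat_r; [apply vnorm_nonneg | apply Rmax_l].
Qed.

(** [dual] carries no vector space operations, so combinations of functionals are specified by their
    values. *)
Lemma dual_lincomb (X : Banach) (f h : dual X) (a b : R) :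
  exists k : dual X, forall x, k x = a * f x + b * h x.
Proof.
  assert (Hb : exists C, forall x, Rabs (a * f x + b * h x) <= C * vnorm X x).
  { destruct (dfun_bnd X f) as [C HC], (dfun_bnd X h) as [D HD].
    exists (Rabs a * C + Rabs b * D). intros x.
    eapply Rle_trans; [apply Rabs_triang|]. rewrite !Rabs_mult.
    specialize (HC x). specialize (HD x).
    pose proof (Rabs_pos a). pose proof (Rabs_pos b). nra. }
  assert (Hadd : forall x y, a * f (x [+] y) + b * h (x [+] y)
                             = (a * f x + b * h x) + (a * f y + b * h y)).
  { intros x y. rewrite !dfun_add. ring. }
  assert (Hscal : forall c x, a * f (c [*] x) + b * h (c [*] x) = c * (a * f x + b * h x)).
  { intros c x. rewrite !dfun_scal. ring. }
  now exists (Build_dual X (fun x => a * f x + b * h x) Hadd Hscal Hb).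
Qed.

(** * Infima of sets of reals *)

Definition is_glb (S : R -> Prop) (m : R) : Prop :=
  (forall x, S x -> m <= x) /\ (forall l, (forall x, S x -> l <= x) -> l <= m).

Lemma glb_exists (S : R -> Prop) :
  (exists x, S x) -> (exists l, forall x, S x -> l <= x) -> exists m, is_glb S m.
Proof.
  intros [x0 Hx0] [l Hl].
  destruct (completeness (fun y => S (- y))) as [M [HM1 HM2]].
  - exists (- l). intros y Hy. specialize (Hl _ Hy). lra.
  - exists (- x0). now rewrite Ropp_involutive.
  - exists (- M). split.
    + intros x Hx. enough (- x <= M) by lra. apply HM1. now rewrite Ropp_involutive.
    + intros k Hk. enough (M <= - k) by lra. apply HM2.
      intros y Hy. specialize (Hk _ Hy). lra.
Qed.

(** Total by choice: the value is arbitrary unless [S] is nonempty and bounded below. *)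
Definition inf (S : R -> Prop) : R := epsilon (inhabits 0) (is_glb S).

Lemma inf_is_glb (S : R -> Prop) :
  (exists x, S x) -> (exists l, forall x, S x -> l <= x) -> is_glb S (inf S).
Proof. intros H1 H2. unfold inf. apply epsilon_spec. now apply glb_exists. Qed.

Lemma glb_approx (S : R -> Prop) (m e : R) :
  is_glb S m -> 0 < e -> exists x, S x /\ x < m + e.
Proof.
  intros [_ H] He. apply NNPP. intros N. enough (m + e <= m) by lra.
  apply H. intros x Hx. apply Rnot_lt_le. intros L. apply N. now exists x.
Qed.

(** * The Hahn-Banach theorem *)

(** Homogeneity is only an inequality for [c > 0], the form that infima satisfy directly;
    [sublinear_scal] recovers equality by scaling back with [/ c]. *)
Definition sublinear {X : Banach} (q : X -> R) : Prop :=
  (forall x y, q (x [+] y) <= q x + q y) /\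
  (forall c x, 0 < c -> q (c [*] x) <= c * q x).

Lemma sublinear_zero (X : Banach) (q : X -> R) : sublinear q -> q (vzero X) = 0.
Proof.
  intros [_ H]. pose proof (H 2 (vzero X)). pose proof (H (1/2) (vzero X)).
  assert (E : forall c, c [*] vzero X = vzero X).
  { intros c. apply vnorm_eq0. rewrite vnorm_scal, vnorm_zero. ring. }
  rewrite E in *. lra.
Qed.

Lemma sublinear_scal (X : Banach) (q : X -> R) (c : R) (x : X) :
  sublinear q -> 0 <= c -> q (c [*] x) = c * q x.
Proof.
  intros Hq [Hc | <-].
  - apply Rle_antisym; [now apply Hq|].
    pose proof (proj2 Hq (/ c) (c [*] x) (Rinv_0_lt_compat _ Hc)) as H.
    rewrite vscal_assoc, Rinv_l, vscal_1 in H by lra.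
    apply (Rmult_le_compat_l c) in H; [|lra].
    rewrite <- Rmult_assoc, Rinv_r in H; lra.
  - rewrite vscal_0, sublinear_zero by assumption. ring.
Qed.

Lemma sublinear_opp_lower (X : Banach) (q : X -> R) (x : X) :
  sublinear q -> - q (vopp X x) <= q x.
Proof.
  intros Hq. pose proof (proj1 Hq x (vopp X x)) as H.
  rewrite vadd_opp, (sublinear_zero X q Hq) in H. lra.
Qed.

Definition linear {X : Banach} (f : X -> R) : Prop :=
  (forall x y, f (x [+] y) = f x + f y) /\ (forall c x, f (c [*] x) = c * f x).

(* The key step: [x |-> inf_{t >= 0} q (x + t y) - t q y] is sublinear and below [q], so a minimal [q] satisfies [q x + q y <= q (x + y)]. *)
Lemma minimal_sublinear_linear (X : Banach) (q : X -> R) :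
  sublinear q ->
  (forall q', sublinear q' -> (forall x, q' x <= q x) -> forall x, q x <= q' x) ->
  linear q.
Proof.
  intros Hq Hmin.
  assert (Hadd : forall x y, q (x [+] y) = q x + q y).
  { intros x y. apply Rle_antisym; [apply Hq|].
    set (S := fun x r => exists t, 0 <= t /\ r = q (x [+] t [*] y) - t * q y).
    assert (HS : forall x, is_glb (S x) (inf (S x))).
    { intros z. apply inf_is_glb.
      - exists (q (z [+] 0 [*] y) - 0 * q y). exists 0. split; [lra | reflexivity].
      (* From [t q y = q (t y) <= q (z + t y) + q (- z)]. *)
      - exists (- q (vopp X z)). intros r (t & Ht & ->).
        pose proof (proj1 Hq (z [+] t [*] y) (vopp X z)) as H.
        rewrite (vadd_comm X z), vadd_sub in H.
        rewrite (sublinear_scal X q t y Hq Ht) in H.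
        rewrite (vadd_comm X z). lra. }
    assert (Hle : q x <= inf (S x)).
    { apply (Hmin (fun x => inf (S x))).
      - split.
        + intros a b. apply Rnot_lt_le. intros L.
          set (e := inf (S (a [+] b)) - (inf (S a) + inf (S b))) in *.
          destruct (glb_approx _ _ (e / 2) (HS a)) as (? & (s & Hs & ->) & H1); [unfold e; lra|].
          destruct (glb_approx _ _ (e / 2) (HS b)) as (? & (t & Ht & ->) & H2); [unfold e; lra|].
          assert (H3 : inf (S (a [+] b)) <=
                       q ((a [+] b) [+] (s + t) [*] y) - (s + t) * q y).
          { apply HS. exists (s + t). split; [lra | reflexivity]. }
          rewrite vscal_distr_s, vadd_shuffle in H3.
          pose proof (proj1 Hq (a [+] s [*] y) (b [+] t [*] y)). unfold e in *. lra.
        + intros c a Hc. apply Rnot_lt_le. intros L.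
          set (e := inf (S (c [*] a)) - c * inf (S a)) in *.
          assert (Hec : 0 < e / c) by (apply Rdiv_lt_0_compat; unfold e; lra).
          destruct (glb_approx _ _ _ (HS a) Hec) as (? & (s & Hs & ->) & H1).
          assert (H3 : inf (S (c [*] a)) <=
                       q (c [*] a [+] (c * s) [*] y) - (c * s) * q y).
          { apply HS. exists (c * s). split; [nra | reflexivity]. }
          rewrite <- vscal_assoc, <- vscal_distr_v in H3.
          rewrite sublinear_scal in H3; [|assumption|lra].
          apply (Rmult_lt_compat_l c) in H1; [|assumption].
          replace (c * (inf (S a) + e / c)) with (c * inf (S a) + e) in H1 by (field; lra).
          unfold e in *. lra.
      - intros z. apply HS. exists 0. split; [lra|].
        rewrite vscal_0, vadd_0. ring. }
    enough (inf (S x) <= q (x [+] y) - q y) by lra.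
    apply HS. exists 1. split; [lra|]. rewrite vscal_1. ring. }
  split; [exact Hadd|].
  assert (Hopp : forall x, q (vopp X x) = - q x).
  { intros x. pose proof (Hadd x (vopp X x)) as H.
    rewrite vadd_opp, (sublinear_zero X q Hq) in H. lra. }
  intros c x. destruct (Rle_or_lt 0 c) as [Hc | Hc].
  - now apply sublinear_scal.
  - replace (c [*] x) with (vopp X ((- c) [*] x)).
    + rewrite Hopp, sublinear_scal by (assumption || lra). ring.
    + rewrite vopp_scal, vscal_assoc. f_equal. ring.
Qed.

(** Zorn's lemma. Members of a chain are at least [- p (- x)] at [x], so their pointwise infimum is
    finite; it is subadditive because two near-minimizers, one for each summand, can be replaced by
    the lower of the two. *)
Lemma minimal_sublinear_exists (X : Banach) (p : X -> R) :
  sublinear p -> exists q, sublinear q /\ (forall x, q x <= p x) /\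
    forall q', sublinear q' -> (forall x, q' x <= q x) -> forall x, q x <= q' x.
Proof.
  intros Hp.
  set (T := {q : X -> R | sublinear q /\ forall x, q x <= p x}).
  (* The order is reversed, so that a maximal element is a minimal functional. *)
  set (below := fun q r : T => forall x, proj1_sig r x <= proj1_sig q x).
  assert (t0 : T) by (exists p; split; [assumption | intros; lra]).
  destruct (@classical_sets.ZL_preorder T t0 (fun q r => boolp.asbool (below q r)))
    as [[q [Hq Hqp]] Hmin].
  - intros q. apply boolp.asboolT. intros x. lra.
  - intros q r s H1 H2. apply boolp.asboolW in H1. apply boolp.asboolW in H2.
    apply boolp.asboolT. intros x. specialize (H1 x). specialize (H2 x). lra.
  - intros A Htot.
    assert (tot : forall r s, A r -> A s -> below r s \/ below s r).
    { intros r s Hr Hs. destruct (Htot r s Hr Hs) as [H | H]; apply boolp.asboolW in H; auto. }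
    destruct (classic (exists s, A s)) as [[s0 Hs0] | Hempty].
    2: { exists t0. intros s Hs. exfalso. apply Hempty. now exists s. }
    set (S := fun x r => exists s : T, A s /\ r = proj1_sig s x).
    assert (HS : forall x, is_glb (S x) (inf (S x))).
    { intros x. apply inf_is_glb.
      - exists (proj1_sig s0 x). now exists s0.
      - exists (- p (vopp X x)). intros r ([s [Hs Hsp]] & _ & ->). simpl.
        pose proof (sublinear_opp_lower X s x Hs). specialize (Hsp (vopp X x)). lra. }
    assert (Hlb : forall s x, A s -> inf (S x) <= proj1_sig s x).
    { intros s x Hs. apply HS. now exists s. }
    assert (Hsub : sublinear (fun x => inf (S x))).
    { split.
      - intros x y. apply Rnot_lt_le. intros L.
        set (e := inf (S (x [+] y)) - (inf (S x) + inf (S y))) in *.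
        destruct (glb_approx _ _ (e / 2) (HS x)) as (? & (s & Hs & ->) & H1); [unfold e; lra|].
        destruct (glb_approx _ _ (e / 2) (HS y)) as (? & (t & Ht & ->) & H2); [unfold e; lra|].
        assert (Hr : exists r, A r /\ below s r /\ below t r).
        { destruct (tot s t Hs Ht) as [H | H]; [exists t | exists s];
            repeat split; try assumption; intros z; lra. }
        destruct Hr as (r & Hr & Hsr & Htr).
        pose proof (Hlb r (x [+] y) Hr). specialize (Hsr x). specialize (Htr y).
        pose proof (proj1 (proj1 (proj2_sig r)) x y). unfold e in *. lra.
      - intros c x Hc. apply Rnot_lt_le. intros L.
        set (e := inf (S (c [*] x)) - c * inf (S x)) in *.
        assert (Hec : 0 < e / c) by (apply Rdiv_lt_0_compat; unfold e; lra).
        destruct (glb_approx _ _ _ (HS x) Hec) as (? & (s & Hs & ->) & H1).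
        pose proof (Hlb s (c [*] x) Hs).
        pose proof (proj2 (proj1 (proj2_sig s)) c x Hc).
        apply (Rmult_lt_compat_l c) in H1; [|assumption].
        replace (c * (inf (S x) + e / c)) with (c * inf (S x) + e) in H1 by (field; lra).
        unfold e in *. lra. }
    unshelve eexists (exist _ (fun x => inf (S x)) _).
    + split; [assumption|]. intros x.
      pose proof (Hlb s0 x Hs0). pose proof (proj2 (proj2_sig s0) x). simpl in *. lra.
    + intros s Hs. apply boolp.asboolT. intros x. simpl. now apply Hlb.
  - exists q. split; [assumption|]. split; [assumption|].
    intros q' Hq' Hle.
    assert (Hq'p : forall x, q' x <= p x).
    { intros x. exact (Rle_trans _ _ _ (Hle x) (Hqp x)). }
    set (t := exist (fun q => sublinear q /\ forall x, q x <= p x) q' (conj Hq' Hq'p) : T).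
    assert (H := Hmin t (boolp.asboolT Hle)). apply boolp.asboolW in H. exact H.
Qed.

(** A minimal sublinear functional below [p] is linear, so its upper bound at [- x] is a lower bound
    at [x]. There is no subspace to extend from: all constraints on [f] are encoded in [p]. *)
Theorem hahn_banach (X : Banach) (p : X -> R) (K : R) :
  sublinear p -> (forall x, p x <= K * vnorm X x) ->
  exists f : dual X, (forall x, f x <= p x) /\ (forall x, Rabs (f x) <= K * vnorm X x).
Proof.
  intros Hp HK. destruct (minimal_sublinear_exists X p Hp) as (q & Hq & Hqp & Hmin).
  destruct (minimal_sublinear_linear X q Hq Hmin) as [Hadd Hscal].
  assert (Hb : forall x, Rabs (q x) <= K * vnorm X x).
  { intros x. pose proof (Rle_trans _ _ _ (Hqp x) (HK x)).
    pose proof (Rle_trans _ _ _ (Hqp (-1 [*] x)) (HK (-1 [*] x))) as H1.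
    rewrite Hscal, vnorm_scal, (Rabs_left (-1)) in H1 by lra. apply Rabs_le. lra. }
  exists (Build_dual X q Hadd Hscal (ex_intro _ K Hb)). now split.
Qed.

(** * Subgradients of closed convex epigraphs *)

(** An extended-valued function on [X] is represented by its epigraph [E]; lower semicontinuity
    becomes closedness of [E] in the product of [X] and the reals. *)
Definition closed_epi {X : Banach} (E : X -> R -> Prop) : Prop :=
  forall y r,
    (forall eps, 0 < eps -> exists u s, E u s /\ vnorm X (u [-] y) < eps /\ Rabs (s - r) < eps) ->
    E y r.

Definition convex_epi {X : Banach} (E : X -> R -> Prop) : Prop :=
  forall u v r s t, 0 <= t <= 1 -> E u r -> E v s ->
    E (t [*] u [+] (1 - t) [*] v) (t * r + (1 - t) * s).

(* Ekeland's variational principle in the form of Phelps' extremization lemma: order [E] by [(u,s) <= (y,r)] iff [s + K |u - y| <= r] and descend, nearly minimizing the second coordinate at each step. *)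
Lemma ekeland (X : Banach) (E : X -> R -> Prop) (K m : R) (z : X) (r0 : R) :
  0 < K -> closed_epi E -> E z r0 ->
  (forall u s, E u s -> s + K * vnorm X (u [-] z) <= r0 -> m <= s) ->
  exists y r, E y r /\ r + K * vnorm X (y [-] z) <= r0 /\
    forall u s, E u s -> r <= s + K * vnorm X (u [-] y).
Proof.
  intros HK Hcl Hz Hm.
  set (le := fun b a : X * R =>
    E (fst b) (snd b) /\ snd b + K * vnorm X (fst b [-] fst a) <= snd a).
  assert (le_trans : forall a b c, le c b -> le b a -> le c a).
  { intros a b c [H1 H2] [H3 H4]. split; [assumption|].
    pose proof (vnorm_sub_triangle X (fst c) (fst b) (fst a)). nra. }
  assert (le_refl : forall a, E (fst a) (snd a) -> le a a).
  { intros a Ha. split; [assumption|]. rewrite vnorm_sub_diag. lra. }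
  set (near := fun n a b => le b a /\ forall c, le c a -> snd b <= snd c + (/ 2) ^ n).
  set (a0 := (z, r0)).
  assert (near_ex : forall n a, le a a0 -> exists b, near n a b).
  { intros n a Ha.
    destruct (glb_exists (fun s => exists b, le b a /\ s = snd b)) as [i Hi].
    - exists (snd a). exists a. split; [apply le_refl, Ha | reflexivity].
    - exists m. intros s (b & Hb & ->).
      destruct (le_trans _ _ _ Hb Ha) as [H1 H2]. exact (Hm _ _ H1 H2).
    - destruct (glb_approx _ _ ((/ 2) ^ n) Hi) as (s & (b & Hb & ->) & Hs);
        [apply pow_lt; lra|].
      exists b. split; [assumption|]. intros c Hc.
      enough (i <= snd c) by lra. apply Hi. now exists c. }
  set (next := fun n a => epsilon (inhabits a0) (near n a)).
  set (sq := nat_rect (fun _ => (X * R)%type) a0 next).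
  assert (Hsq : forall n, le (sq n) a0).
  { induction n as [|n IH]; [now apply le_refl|].
    apply (le_trans _ (sq n)); [|assumption].
    exact (proj1 (epsilon_spec (inhabits a0) _ (near_ex n _ IH))). }
  assert (Hnext : forall n, near n (sq n) (sq (S n))).
  { intros n. exact (epsilon_spec (inhabits a0) _ (near_ex n _ (Hsq n))). }
  assert (Hmono : forall n k, (n <= k)%nat -> le (sq k) (sq n)).
  { intros n k H. induction H as [|k H IH]; [apply le_refl, Hsq|].
    apply (le_trans _ (sq k)); [apply Hnext | assumption]. }
  destruct (glb_exists (fun s => exists n, s = snd (sq n))) as [r Hr].
  { exists r0. now exists O. }
  { exists m. intros s [n ->]. apply (Hm (fst (sq n))); apply (Hsq n). }
  assert (Hrn : forall n, r <= snd (sq n)) by (intros n; apply Hr; now exists n).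
  (* The second coordinates descend to [r] and [le] charges every move against them, so the first
     coordinates form a Cauchy sequence. *)
  assert (Hdist : forall n k, (n <= k)%nat ->
            K * vnorm X (fst (sq k) [-] fst (sq n)) <= snd (sq n) - r).
  { intros n k H. destruct (Hmono n k H) as [_ H1]. specialize (Hrn k). lra. }
  destruct (vcomplete X (fun n => fst (sq n))) as [y Hy].
  { intros eps Heps.
    assert (HKe : 0 < K * eps / 2) by (apply Rdiv_lt_0_compat; nra).
    destruct (glb_approx _ _ _ Hr HKe) as (s & [N ->] & HN).
    exists N. intros j k Hj Hk.
    pose proof (vnorm_sub_triangle X (fst (sq j)) (fst (sq N)) (fst (sq k))) as Ht.
    rewrite (vnorm_sub_sym X (fst (sq N))) in Ht.
    pose proof (Hdist N j Hj). pose proof (Hdist N k Hk).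
    apply (Rmult_lt_reg_l K); [assumption|]. nra. }
  assert (Hlim : forall n eps, 0 < eps -> exists k, (n <= k)%nat /\
            vnorm X (fst (sq k) [-] y) < eps /\ Rabs (snd (sq k) - r) < eps).
  { intros n eps Heps. destruct (Hy eps Heps) as [N1 HN1].
    destruct (glb_approx _ _ _ Hr Heps) as (s & [N2 ->] & HN2).
    exists (n + N1 + N2)%nat. split; [lia|]. split; [apply HN1; lia|].
    destruct (Hmono N2 (n + N1 + N2)%nat ltac:(lia)) as [_ H].
    pose proof (vnorm_nonneg X (fst (sq (n + N1 + N2)%nat) [-] fst (sq N2))).
    specialize (Hrn (n + N1 + N2)%nat). apply Rabs_def1; nra. }
  assert (HE : E y r).
  { apply Hcl. intros eps Heps. destruct (Hlim O eps Heps) as (k & _ & H1 & H2).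
    exists (fst (sq k)), (snd (sq k)). split; [apply Hsq|]. now split. }
  assert (Hyn : forall n, le (y, r) (sq n)).
  { intros n. split; [assumption|]. simpl. apply le_epsilon. intros e He.
    assert (HeK : 0 < e / K) by now apply Rdiv_lt_0_compat.
    destruct (Hlim n _ HeK) as (k & Hk & H1 & _).
    pose proof (Hdist n k Hk).
    pose proof (vnorm_sub_triangle X y (fst (sq k)) (fst (sq n))) as Ht.
    rewrite (vnorm_sub_sym X y (fst (sq k))) in Ht.
    apply (Rmult_lt_compat_l K) in H1; [|assumption].
    replace (K * (e / K)) with e in H1 by (field; lra). nra. }
  exists y, r. split; [assumption|]. split; [apply (Hyn O)|].
  (* A violating [(u, s)] would lie below every [sq N]; near-minimality then gives
     [snd (sq (S N)) <= s + (/ 2) ^ N < r] for large [N]. *)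
  intros u s Hu. apply Rnot_lt_le. intros L.
  pose proof (vnorm_nonneg X (u [-] y)).
  assert (Hlt : 0 < r - s) by nra.
  destruct (pow_lt_1_zero (/ 2)) with (y := r - s) as [N HN];
    [rewrite Rabs_pos_eq; lra | assumption |].
  specialize (HN N (le_n N)). rewrite Rabs_pos_eq in HN by (apply pow_le; lra).
  assert (Hus : le (u, s) (sq N)).
  { apply (le_trans _ (y, r)); [|apply Hyn]. split; [assumption | simpl; lra]. }
  pose proof (proj2 (Hnext N) _ Hus). specialize (Hrn (S N)). simpl snd in *. lra.
Qed.

(* Hahn-Banach applied to the infimal convolution of [K |.|] and the cone generated by [E - (y,r)]. *)
Lemma bounded_subgradient (X : Banach) (E : X -> R -> Prop) (K : R) (y : X) (r : R) :
  0 <= K -> convex_epi E -> E y r ->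
  (forall u s, E u s -> r <= s + K * vnorm X (u [-] y)) ->
  exists f : dual X, (forall u s, E u s -> f u - f y <= s - r) /\
    (forall v, Rabs (f v) <= K * vnorm X v).
Proof.
  intros K0 Hc Hy HK.
  (* The constraint is [v = t (u - y) + d], a cone part plus a remainder charged at rate [K]. *)
  set (S := fun v a => exists t u s d, 0 <= t /\ E u s /\ t [*] u [+] d = v [+] t [*] y /\
                         a = t * (s - r) + K * vnorm X d).
  assert (HS : forall v, is_glb (S v) (inf (S v))).
  { intros v. apply inf_is_glb.
    - exists (0 * (r - r) + K * vnorm X v), 0, y, r, v.
      split; [lra|]. split; [assumption|]. split; [|reflexivity].
      rewrite vscal_0. apply vadd_comm.
    (* Here [s - r >= - K |u - y|] and [t |u - y| <= |v| + |d|]. *)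
    - exists (- (K * vnorm X v)). intros a (t & u & s & d & Ht & Hu & Hd & ->).
      specialize (HK u s Hu).
      assert (Hn : t * vnorm X (u [-] y) <= vnorm X v + vnorm X d).
      { rewrite <- (Rabs_pos_eq t Ht), <- vnorm_scal.
        rewrite vscal_distr_v, vscal_opp, (vadd_eq_sub _ _ _ _ _ Hd).
        eapply Rle_trans; [apply vnorm_triangle|].
        rewrite vopp_scal, vnorm_scal, (Rabs_left (-1)) by lra. lra. }
      pose proof (Rmult_le_compat_l t _ _ Ht HK).
      pose proof (Rmult_le_compat_l K _ _ K0 Hn). nra. }
  assert (Hsub : sublinear (fun v => inf (S v))).
  { split.
    - intros v1 v2. apply Rnot_lt_le. intros L.
      set (e := inf (S (v1 [+] v2)) - (inf (S v1) + inf (S v2))) in *.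
      destruct (glb_approx _ _ (e / 2) (HS v1))
        as (? & (t1 & u1 & s1 & d1 & Ht1 & Hu1 & Hd1 & ->) & H1); [unfold e; lra|].
      destruct (glb_approx _ _ (e / 2) (HS v2))
        as (? & (t2 & u2 & s2 & d2 & Ht2 & Hu2 & Hd2 & ->) & H2); [unfold e; lra|].
      (* Two cone elements add up to one based at a weighted mean; if both weights vanish, [(y, r)]
         serves as base. *)
      assert (Hcomb : exists u s, E u s /\ (t1 + t2) [*] u = t1 [*] u1 [+] t2 [*] u2 /\
                        (t1 + t2) * s = t1 * s1 + t2 * s2).
      { destruct (Req_dec (t1 + t2) 0) as [H0 | H0].
        - assert (t1 = 0) by lra. assert (t2 = 0) by lra. subst.
          exists y, r. split; [assumption|]. split; [|ring].
          rewrite Rplus_0_l, !vscal_0, vadd_0. reflexivity.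
        - exists (t1 / (t1 + t2) [*] u1 [+] (1 - t1 / (t1 + t2)) [*] u2),
            (t1 / (t1 + t2) * s1 + (1 - t1 / (t1 + t2)) * s2).
          split.
          + apply Hc; [|assumption|assumption]. split.
            * apply Rmult_le_pos; [lra|]. left. apply Rinv_0_lt_compat. lra.
            * apply (Rmult_le_reg_r (t1 + t2)); [lra|]. unfold Rdiv.
              rewrite Rmult_assoc, Rinv_l; lra.
          + split; [|field; lra]. rewrite vscal_distr_v, !vscal_assoc.
            f_equal; f_equal; field; lra. }
      destruct Hcomb as (u & s & Hu & Eu & Es).
      assert (H3 : inf (S (v1 [+] v2)) <= (t1 + t2) * (s - r) + K * vnorm X (d1 [+] d2)).
      { apply HS. exists (t1 + t2), u, s, (d1 [+] d2). split; [lra|]. split; [assumption|].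
        split; [|reflexivity].
        rewrite Eu, vadd_shuffle, Hd1, Hd2, vscal_distr_s. apply vadd_shuffle. }
      pose proof (Rmult_le_compat_l K _ _ K0 (vnorm_triangle X d1 d2)). unfold e in *. nra.
    - intros c v Hc0. apply Rnot_lt_le. intros L.
      set (e := inf (S (c [*] v)) - c * inf (S v)) in *.
      assert (Hec : 0 < e / c) by (apply Rdiv_lt_0_compat; unfold e; lra).
      destruct (glb_approx _ _ _ (HS v) Hec)
        as (? & (t & u & s & d & Ht & Hu & Hd & ->) & H1).
      assert (H3 : inf (S (c [*] v)) <= (c * t) * (s - r) + K * vnorm X (c [*] d)).
      { apply HS. exists (c * t), u, s, (c [*] d). split; [nra|]. split; [assumption|].
        split; [|reflexivity].
        rewrite <- !vscal_assoc, <- !vscal_distr_v, Hd. reflexivity. }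
      rewrite vnorm_scal, Rabs_pos_eq in H3 by lra.
      apply (Rmult_lt_compat_l c) in H1; [|assumption].
      replace (c * (inf (S v) + e / c)) with (c * inf (S v) + e) in H1 by (field; lra).
      unfold e in *. lra. }
  destruct (hahn_banach X _ K Hsub) as (f & Hf & Hfb).
  { intros v. apply HS. exists 0, y, r, v. split; [lra|]. split; [assumption|].
    split; [rewrite vscal_0; apply vadd_comm | ring]. }
  exists f. split; [|assumption]. intros u s Hu.
  rewrite <- dfun_sub. eapply Rle_trans; [apply Hf|].
  apply HS. exists 1, u, s, (vzero X). split; [lra|]. split; [assumption|].
  split; [|rewrite vnorm_zero; ring].
  rewrite !vscal_1, vadd_0, vsub_add. reflexivity.
Qed.

(** * Biconjugation in the weak-star topology *)

(** The combination [u] is given by its values and [c] may be smaller than the combined height, so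
    that the graph of a convex function qualifies, not only its epigraph. *)
Definition convex_graph {X : Banach} (P : dual X -> R -> Prop) : Prop :=
  forall z w a b t, 0 <= t <= 1 -> P z a -> P w b ->
    exists u c, P u c /\ (forall x, u x = t * z x + (1 - t) * w x) /\ c <= t * a + (1 - t) * b.

(** A single seminorm for finitely many weak-star conditions, which turns a neighbourhood into a
    penalty. *)
Fixpoint l1_dist {X : Banach} (l : list X) (z y : dual X) : R :=
  match l with
  | nil => 0
  | x :: l' => Rabs (z x - y x) + l1_dist l' z y
  end.

Lemma l1_dist_nonneg (X : Banach) (l : list X) (z y : dual X) : 0 <= l1_dist l z y.
Proof.
  induction l as [|x l IH]; simpl; [lra|]. pose proof (Rabs_pos (z x - y x)). lra.
Qed.

Lemma l1_dist_in (X : Banach) (l : list X) (z y : dual X) (x : X) :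
  In x l -> Rabs (z x - y x) <= l1_dist l z y.
Proof.
  induction l as [|x' l IH]; simpl; [easy|]. intros [-> | H].
  - pose proof (l1_dist_nonneg X l z y). lra.
  - pose proof (Rabs_pos (z x' - y x')). specialize (IH H). lra.
Qed.

(** One-dimensional Hahn-Banach: points with [z x > y x] bound [k] from below, those with
    [z x < y x] from above. The bounds are compatible because a segment joining two such points
    crosses [z x = y x], where the penalty vanishes. *)
Lemma separation_step (X : Banach) (P : dual X -> R -> Prop) (K : R) (x x' : X) (y : dual X) :
  convex_graph P -> 0 <= K ->
  (forall z a, P z a -> 0 <= a + K * Rabs (z x - y x) + (z x' - y x')) ->
  exists k, forall z a, P z a -> 0 <= a + k * (z x - y x) + (z x' - y x').
Proof.
  intros Hconv HK H.
  (* The lower bounds on [k]; [- K] keeps the set nonempty and respects all upper bounds by the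
     penalized inequality. *)
  set (S := fun k => k = - K \/
    exists z a, P z a /\ 0 < z x - y x /\ k * (z x - y x) = - (a + (z x' - y x'))).
  assert (Hupper : forall w b, P w b -> w x - y x < 0 ->
            forall k, S k -> k * (w x - y x) + (b + (w x' - y x')) >= 0).
  { intros w b Hw Hneg k [-> | (z & a & Hz & Hpos & Hk)].
    - specialize (H w b Hw). rewrite Rabs_left in H by assumption. nra.
    - set (p := z x - y x) in *. set (n := w x - y x) in *.
      assert (Hpn : 0 < p - n) by lra.
      (* The weight at which the combination takes the value [y x] at [x]. *)
      destruct (Hconv z w a b (- n / (p - n))) as (u & c & Hu & Eu & Hcle);
        [|assumption|assumption|].
      { split.
        - apply Rmult_le_pos; [lra|]. left. now apply Rinv_0_lt_compat.
        - apply (Rmult_le_reg_r (p - n)); [lra|]. unfold Rdiv.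
          rewrite Rmult_assoc, Rinv_l; lra. }
      specialize (H u c Hu). rewrite !Eu in H.
      replace (_ * z x + _ * w x - y x) with 0 in H by (unfold p, n in *; field; lra).
      rewrite Rabs_R0 in H.
      assert (H' : 0 <= - n * (a + (z x' - y x')) + p * (b + (w x' - y x'))).
      { apply (Rmult_le_reg_r (/ (p - n))); [now apply Rinv_0_lt_compat|].
        rewrite Rmult_0_l.
        replace (_ * / (p - n)) with
          (- n / (p - n) * a + (1 - - n / (p - n)) * b
           + (- n / (p - n) * z x' + (1 - - n / (p - n)) * w x' - y x')) by (field; lra).
        lra. }
      nra. }
  assert (Hmain : exists k, (forall j, S j -> j <= k) /\
            forall w b, P w b -> w x - y x < 0 -> k * (w x - y x) + (b + (w x' - y x')) >= 0).
  { destruct (classic (exists w b, P w b /\ w x - y x < 0)) as [(w0 & b0 & Hw0 & Hn0) | Hno].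
    - destruct (completeness S) as [k [Hk1 Hk2]].
      + exists ((b0 + (w0 x' - y x')) / - (w0 x - y x)). intros j Hj.
        specialize (Hupper _ _ Hw0 Hn0 j Hj).
        apply (Rmult_le_reg_r (- (w0 x - y x))); [lra|]. unfold Rdiv.
        rewrite Rmult_assoc, Rinv_l; lra.
      + exists (- K). now left.
      + exists k. split; [exact Hk1|]. intros w b Hw Hn.
        assert (k <= (b + (w x' - y x')) / - (w x - y x)).
        { apply Hk2. intros j Hj. specialize (Hupper _ _ Hw Hn j Hj).
          apply (Rmult_le_reg_r (- (w x - y x))); [lra|]. unfold Rdiv.
          rewrite Rmult_assoc, Rinv_l; lra. }
        apply (Rmult_le_compat_r (- (w x - y x))) in H0; [|lra]. unfold Rdiv in H0.
        rewrite Rmult_assoc, Rinv_l in H0; lra.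
    - exists K. split.
      + intros j [-> | (z & a & Hz & Hpos & Hj)]; [lra|].
        specialize (H z a Hz). rewrite Rabs_pos_eq in H by lra. nra.
      + intros w b Hw Hn. exfalso. apply Hno. now exists w, b. }
  destruct Hmain as (k & Hk1 & Hk2). exists k. intros z a Hz.
  destruct (Rtotal_order (z x - y x) 0) as [Hn | [H0 | Hp]].
  - specialize (Hk2 z a Hz Hn). lra.
  - specialize (H z a Hz). rewrite H0, Rabs_R0 in H. rewrite H0. lra.
  - assert (Hj : S (- (a + (z x' - y x')) / (z x - y x))).
    { right. exists z, a. split; [assumption|]. split; [assumption|]. field. lra. }
    apply Hk1 in Hj. apply (Rmult_le_compat_r (z x - y x)) in Hj; [|lra].
    unfold Rdiv in Hj. rewrite Rmult_assoc, Rinv_l in Hj; lra.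
Qed.

(** The penalty is linearized one coordinate at a time: the head term is absorbed into the graph,
    which stays convex, and [separation_step] linearizes it after the tail. Hence [P] varies in the
    induction. *)
Lemma separation_l1 (X : Banach) (K : R) (y : dual X) (l : list X) :
  0 <= K -> forall P : dual X -> R -> Prop, convex_graph P ->
  (forall z a, P z a -> 0 <= a + K * l1_dist l z y) ->
  exists x, forall z a, P z a -> 0 <= a + (z x - y x).
Proof.
  intros HK. induction l as [|x l IH]; intros P Hconv H.
  - exists (vzero X). intros z a Hz. specialize (H z a Hz). simpl in H.
    rewrite <- (vscal_0 X (vzero X)), !dfun_scal. lra.
  - destruct (IH (fun z a' => exists a, P z a /\ a' = a + K * Rabs (z x - y x))) as [x' Hx'].
    + intros z w a' b' t Ht (a & Hz & ->) (b & Hw & ->).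
      destruct (Hconv z w a b t Ht Hz Hw) as (u & c & Hu & Eu & Hc).
      exists u, (c + K * Rabs (u x - y x)).
      split; [now exists c|]. split; [assumption|].
      assert (Rabs (u x - y x) <= t * Rabs (z x - y x) + (1 - t) * Rabs (w x - y x)).
      { rewrite Eu.
        replace (t * z x + (1 - t) * w x - y x)
          with (t * (z x - y x) + (1 - t) * (w x - y x)) by ring.
        eapply Rle_trans; [apply Rabs_triang|].
        rewrite !Rabs_mult, (Rabs_pos_eq t), (Rabs_pos_eq (1 - t)); lra. }
      apply (Rmult_le_compat_l K) in H0; [|assumption]. lra.
    + intros z a' (a & Hz & ->). specialize (H z a Hz). simpl in H. lra.
    + destruct (separation_step X P K x x' y Hconv HK) as [k Hk].
      { intros z a Hz. apply Hx'. now exists a. }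
      exists (k [*] x [+] x'). intros z a Hz. specialize (Hk z a Hz).
      rewrite !dfun_add, !dfun_scal. lra.
Qed.

(* The epigraph of the restriction of the conjugate of [g] to [X]. *)
Definition conj_epi {X : Banach} (g : dual X -> ER) (x : X) (r : R) : Prop :=
  forall ys b, g ys = Fin b -> ys x - b <= r.

Lemma conj_epi_convex (X : Banach) (g : dual X -> ER) : convex_epi (conj_epi g).
Proof.
  intros u v r s t Ht Hu Hv ys b Hb.
  specialize (Hu ys b Hb). specialize (Hv ys b Hb).
  rewrite dfun_add, !dfun_scal. nra.
Qed.

Lemma conj_epi_closed (X : Banach) (g : dual X -> ER) : closed_epi (conj_epi g).
Proof.
  intros y r H ys b Hb. destruct (dual_bound X ys) as (C & HC0 & HC).
  apply le_epsilon. intros e He.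
  destruct (H (e / (C + 1))) as (u & s & Hu & H1 & H2); [apply Rdiv_lt_0_compat; lra|].
  specialize (Hu ys b Hb). specialize (HC (u [-] y)). rewrite dfun_sub in HC.
  apply Rabs_def2 in H2. pose proof (Rle_abs (- (ys u - ys y))) as H3.
  rewrite Rabs_Ropp in H3.
  assert (He' : (C + 1) * (e / (C + 1)) = e) by (field; lra).
  assert (C * vnorm X (u [-] y) <= C * (e / (C + 1))) by (apply Rmult_le_compat_l; lra).
  lra.
Qed.

Lemma subdiffX_conj_epi (X : Banach) (g : dual X -> ER) (ys : dual X) (y : X) (a : R) :
  g ys = Fin a -> subdiffX g ys y -> conj_epi g y (ys y - a).
Proof.
  intros Ha (a' & Ha' & H) zs b Hb. rewrite Ha in Ha'. injection Ha' as <-.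
  specialize (H zs b Hb). lra.
Qed.

(* The affine minorant given by [(x0, m0)] makes the penalty enforceable also where [g xs] is infinite. *)
Lemma biconjugate (X : Banach) (g : dual X -> ER) (x0 : X) (m0 c : R) (xs : dual X) :
  convex g -> weak_star_lsc g -> conj_epi g x0 m0 -> lt_ER (Fin c) (g xs) ->
  exists x r, conj_epi g x r /\ c < xs x - r.
Proof.
  intros Hconv Hlsc Hx0 Hc.
  (* The minorant found has value exactly [c1] at [xs], so room above [c] is taken first. *)
  assert (Hc1 : exists c1, c < c1 /\ lt_ER (Fin c1) (g xs)).
  { destruct (g xs) as [a|]; simpl in *; [exists ((c + a) / 2) | exists (c + 1)];
      split; trivial; lra. }
  destruct Hc1 as (c1 & Hcc1 & Hc1).
  destruct (Hlsc c1 xs Hc1) as (l & eps & Heps & Hl).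
  set (A := Rabs (xs x0 - m0 - c1)).
  assert (HA : 0 <= A / eps).
  { apply Rmult_le_pos; [apply Rabs_pos|]. left. now apply Rinv_0_lt_compat. }
  (* Far from [xs], [b - c1 >= - |z x0 - xs x0| - A]: coefficient [1] pays for the first term, as
     [x0] is in the list, and [A / eps] for the second, as some coordinate is off by at least
     [eps]. *)
  destruct (separation_l1 X (1 + A / eps) xs (x0 :: l)) with
    (P := fun z a => exists b, g z = Fin b /\ a = b - c1) as [x Hx]; [lra| | |].
  - intros z w a b t Ht (a' & Ha & ->) (b' & Hb & ->).
    destruct (dual_lincomb X z w t (1 - t)) as [u Hu].
    pose proof (Hconv z w u t a' b' Ht Hu Ha Hb) as H.
    destruct (g u) as [d|] eqn:Hd; [|contradiction]. simpl in H.
    exists u, (d - c1). split; [now exists d|]. split; [assumption | lra].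
  - intros z a (b & Hb & ->). simpl.
    pose proof (l1_dist_nonneg X l z xs). pose proof (Rabs_pos (z x0 - xs x0)).
    destruct (classic (forall x, In x l -> Rabs (z x - xs x) < eps)) as [Hnear | Hfar].
    + specialize (Hl z Hnear). rewrite Hb in Hl. simpl in Hl. nra.
    + apply not_all_ex_not in Hfar. destruct Hfar as [x Hfar].
      apply imply_to_and in Hfar. destruct Hfar as [Hin Hfar].
      apply Rnot_lt_le in Hfar. pose proof (l1_dist_in X l z xs x Hin).
      pose proof (Hx0 z b Hb).
      pose proof (Rle_abs (- (z x0 - xs x0))) as H3. rewrite Rabs_Ropp in H3.
      pose proof (Rle_abs (- (xs x0 - m0 - c1))) as H4. rewrite Rabs_Ropp in H4. fold A in H4.
      assert (A / eps * eps = A) by (field; lra).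
      assert (A / eps * eps <= A / eps * l1_dist l z xs)
        by (apply Rmult_le_compat_l; lra).
      nra.
  - exists (vopp X x), (- xs x - c1). split.
    + intros z b Hb. specialize (Hx z (b - c1) (ex_intro _ b (conj Hb eq_refl))).
      rewrite dfun_opp. lra.
    + rewrite dfun_opp. lra.
Qed.

(** If [g ys > ys y - r], [biconjugate] would give a pair of the epigraph violating the subgradient
    inequality. So [g ys] is finite and at most [ys y - r], and [conj_epi g y r] does the rest. *)
Lemma conj_subgradient_subdiffX (X : Banach) (g : dual X -> ER) (ys : dual X) (y : X) (r : R) :
  convex g -> weak_star_lsc g -> conj_epi g y r ->
  (forall u s, conj_epi g u s -> ys u - ys y <= s - r) -> subdiffX g ys y.
Proof.
  intros Hconv Hlsc Hy Hsub.
  assert (Hn : ~ lt_ER (Fin (ys y - r)) (g ys)).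
  { intros H. destruct (biconjugate X g y r _ ys Hconv Hlsc Hy H) as (u & s & Hu & Hlt).
    specialize (Hsub u s Hu). lra. }
  destruct (g ys) as [a|] eqn:Ha; [|exfalso; now apply Hn].
  simpl in Hn. exists a. split; [assumption|]. intros zs b Hb.
  specialize (Hy zs b Hb). lra.
Qed.

(** * Values of the conjugate and subgradients at nearby points *)

Definition is_conj {X : Banach} (g : dual X -> ER) (x : X) (r : R) : Prop :=
  conj_epi g x r /\ forall s, conj_epi g x s -> r <= s.

Lemma is_conj_exists (X : Banach) (g : dual X -> ER) (x : X) (M : R) :
  proper g -> conj_epi g x M -> exists r, is_conj g x r.
Proof.
  intros [zs Hzs] HM. unfold in_dom in Hzs.
  destruct (g zs) as [a|] eqn:Ha; [|contradiction].
  destruct (completeness (fun s => exists ys b, g ys = Fin b /\ s = ys x - b)) as [r [H1 H2]].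
  - exists M. intros s (ys & b & Hb & ->). now apply HM.
  - exists (zs x - a), zs, a. now split.
  - exists r. split.
    + intros ys b Hb. apply H1. now exists ys, b.
    + intros s Hs. apply H2. intros q (ys & b & Hb & ->). now apply Hs.
Qed.

(* A Bronsted-Rockafellar statement: Ekeland with a large slope [K] keeps [K |y - z|], hence [<ys, y - z>], small. *)
Lemma subdiffX_approx (X : Banach) (g : dual X -> ER) (z : X) (r0 : R) (p : dual X) (eta : R) :
  convex g -> weak_star_lsc g -> is_conj g z r0 -> 0 < eta ->
  exists (y : X) (ys : dual X) (r : R), subdiffX g ys y /\
    (forall u s, conj_epi g u s -> ys u - ys y <= s - r) /\
    Rabs (p y - p z) <= eta /\ ys y - ys z <= eta /\ r0 - eta <= r.
Proof.
  intros Hconv Hlsc [Hz Hleast] Heta.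
  (* A functional nearly attaining the supremum at [z] bounds the conjugate below with slope at most
     [C]. *)
  assert (Hmin : exists zs b, g zs = Fin b /\ r0 - eta / 2 < zs z - b).
  { apply NNPP. intros N. enough (r0 <= r0 - eta / 2) by lra. apply Hleast.
    intros zs b Hb. apply Rnot_lt_le. intros L. apply N. now exists zs, b. }
  destruct Hmin as (zs & b & Hb & Hlow).
  destruct (dual_bound X zs) as (C & HC0 & HC), (dual_bound X p) as (D & HD0 & HD).
  (* [K - C = C + D + 1], so this multiple of the displacement is at most [eta / 2]; it covers [D]
     for [p], and [K <= 2 (C + D + 1)] covers the new functional. *)
  set (K := 2 * C + D + 1).
  assert (Hbelow : forall u s, conj_epi g u s -> r0 - eta / 2 - C * vnorm X (u [-] z) <= s).
  { intros u s Hu. specialize (Hu zs b Hb). specialize (HC (u [-] z)).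
    rewrite dfun_sub in HC. pose proof (Rle_abs (- (zs u - zs z))) as H.
    rewrite Rabs_Ropp in H. lra. }
  assert (Hclose : forall u s, conj_epi g u s -> s + K * vnorm X (u [-] z) <= r0 ->
            (C + D + 1) * vnorm X (u [-] z) <= eta / 2).
  { intros u s Hu Hs. specialize (Hbelow u s Hu). unfold K in Hs. lra. }
  destruct (ekeland X (conj_epi g) K (r0 - eta) z r0) as (y & r & Hy & Hyr & Hyek).
  { unfold K. lra. }
  { apply conj_epi_closed. }
  { assumption. }
  { intros u s Hu Hs. specialize (Hclose u s Hu Hs). specialize (Hbelow u s Hu).
    pose proof (vnorm_nonneg X (u [-] z)). nra. }
  destruct (bounded_subgradient X (conj_epi g) K y r) as (ys & Hys & HysK).
  { unfold K. lra. }
  { apply conj_epi_convex. }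
  { assumption. }
  { assumption. }
  pose proof (Hclose y r Hy Hyr). pose proof (Hbelow y r Hy).
  pose proof (vnorm_nonneg X (y [-] z)).
  assert (Hr : r0 - eta <= r) by nra.
  exists y, ys, r. split; [now apply (conj_subgradient_subdiffX X g ys y r)|].
  split; [assumption|]. split; [|split; [|assumption]].
  - rewrite <- dfun_sub. eapply Rle_trans; [apply HD|]. nra.
  - rewrite <- dfun_sub. eapply Rle_trans; [apply Rle_abs|].
    eapply Rle_trans; [apply HysK|]. lra.
Qed.

(** * Chains *)

Lemma sumR_shift (f : nat -> R) (n : nat) :
  sumR f (S n) = f O + sumR (fun i => f (S i)) n.
Proof.
  induction n as [|n IH]; [simpl; ring|].
  change (sumR f (S (S n))) with (sumR f (S n) + f (S n)). rewrite IH. simpl. ring.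
Qed.

Lemma chain_sums_last (X : Banach) (g : dual X -> ER) (q xs : dual X) (x : X) :
  subdiffX g q x -> chain_sums g q xs (xs x - q x).
Proof.
  intros H. exists O, (fun _ => q), (fun _ => x). split; [reflexivity|].
  split; [now intros|]. simpl. ring.
Qed.

(** Chains grow at the front, the order in which [backward_chain] finds their nodes. *)
Lemma chain_sums_cons (X : Banach) (g : dual X -> ER) (q p xs : dual X) (x : X) (v : R) :
  subdiffX g q x -> chain_sums g p xs v -> chain_sums g q xs (p x - q x + v).
Proof.
  intros Hq (n & ps & pts & Hp & Hsub & ->).
  exists (S n), (fun i => match i with O => q | S j => ps j end),
    (fun i => match i with O => x | S j => pts j end).
  split; [reflexivity|]. split.
  - intros [|i] Hi; [assumption|]. apply Hsub. lia.
  - rewrite sumR_shift, Hp. ring.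
Qed.

(** Each term is at most the increment of [g] between consecutive nodes, by the subgradient
    inequality, and the increments telescope. *)
Lemma chain_sums_upper (X : Banach) (g : dual X -> ER) (p xs : dual X) (a b v : R) :
  g p = Fin a -> g xs = Fin b -> chain_sums g p xs v -> v <= b - a.
Proof.
  intros Ha Hb (n & ps & pts & Hp & Hsub & ->).
  assert (H : forall k, (k <= n)%nat -> exists c, g (ps k) = Fin c /\
            sumR (fun i => ps (S i) (pts i) - ps i (pts i)) k <= c - a).
  { induction k as [|k IH]; intros Hk.
    - exists a. rewrite Hp. split; [assumption | simpl; lra].
    - destruct (IH ltac:(lia)) as (c & Hc & Hle).
      destruct (Hsub k ltac:(lia)) as (c' & Hc' & H1).
      rewrite Hc in Hc'. injection Hc' as <-.
      destruct (Hsub (S k) Hk) as (d & Hd & _). exists d. split; [assumption|].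
      specialize (H1 _ _ Hd). simpl. lra. }
  destruct (H n (le_n n)) as (c & Hc & Hle).
  destruct (Hsub n (le_n n)) as (c' & Hc' & H1).
  rewrite Hc in Hc'. injection Hc' as <-. specialize (H1 _ _ Hb). lra.
Qed.

(** The division points are convex combinations of [xb] and [x0]. The step [w] is known only through
    functionals, so convexity is checked for each [ys]. *)
Lemma conj_epi_segment (X : Banach) (g : dual X -> ER) (x0 xb w : X) (m0 M : R) (N k : nat) :
  conj_epi g x0 m0 -> conj_epi g xb M ->
  (forall f : dual X, INR N * f w = f xb - f x0) -> (0 < N)%nat -> (k <= N)%nat ->
  conj_epi g (xb [-] INR k [*] w) (Rmax m0 M).
Proof.
  intros Hx0 Hxb Hw HN Hk ys b Hb.
  specialize (Hx0 ys b Hb). specialize (Hxb ys b Hb). specialize (Hw ys).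
  rewrite dfun_sub, dfun_scal.
  pose proof (Rmax_l m0 M). pose proof (Rmax_r m0 M).
  apply lt_0_INR in HN. apply le_INR in Hk. pose proof (pos_INR k).
  apply (Rmult_le_reg_l (INR N)); [assumption|].
  replace (INR N * (ys xb - INR k * ys w - b)) with
    ((INR N - INR k) * (ys xb - b) + INR k * (ys x0 - b)).
  - nra.
  - replace (INR N * (ys xb - INR k * ys w - b)) with
      (INR N * (ys xb - b) - INR k * (INR N * ys w)) by ring. rewrite Hw. ring.
Qed.

(* The chain is built backwards, from [xb] towards [x0]: the point next to [xb - k w] is chosen after, hence as close as needed in terms of, the functional of the following node. The first alternative is the empty chain. *)
Lemma backward_chain (X : Banach) (g : dual X -> ER) (xs : dual X) (x0 xb w : X) (m0 M : R)
  (N k : nat) :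
  proper g -> convex g -> weak_star_lsc g -> conj_epi g x0 m0 -> conj_epi g xb M ->
  (forall f : dual X, INR N * f w = f xb - f x0) -> (0 < N)%nat -> (k <= N)%nat ->
  forall r eta, is_conj g (xb [-] INR k [*] w) r -> 0 < eta ->
  exists (p : dual X) (v : R), ((p = xs /\ v = 0) \/ chain_sums g p xs v) /\
    xs (xb [-] w) - M + r - eta <= p (xb [-] INR (S k) [*] w) + v.
Proof.
  intros Hproper Hconv Hlsc Hx0 Hxb Hw HN.
  induction k as [|k IH]; intros Hk r eta Hr Heta.
  - exists xs, 0. split; [now left|].
    assert (r <= M).
    { apply Hr. intros ys b Hb. specialize (Hxb ys b Hb).
      rewrite dfun_sub, dfun_scal. simpl. lra. }
    rewrite !dfun_sub, dfun_scal. simpl. lra.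
  - assert (Hseg : conj_epi g (xb [-] INR k [*] w) (Rmax m0 M)).
    { apply (conj_epi_segment X g x0 xb w m0 M N k); [assumption.. | lia]. }
    destruct (is_conj_exists X g _ _ Hproper Hseg) as [r1 Hr1].
    (* Five errors, with [z] the division point [xb - (k + 1) w]: one inherited, one for [p], one
       for [ry], and [ys y - ys z] twice, since [ys (z - w) = 2 ys z - ys (z + w)] and the
       subgradient inequality is used at [z + w]. *)
    destruct (IH ltac:(lia) r1 (eta / 5) Hr1) as (p & v & Hpv & Hle); [lra|].
    destruct (subdiffX_approx X g _ r p (eta / 5) Hconv Hlsc Hr)
      as (y & ys & ry & Hsub & Hgrad & Hp & Hys & Hry); [lra|].
    exists ys, (p y - ys y + v). split.
    + right. destruct Hpv as [[-> ->] | Hpv].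
      * rewrite Rplus_0_r. now apply chain_sums_last.
      * now apply chain_sums_cons.
    + specialize (Hgrad _ _ (proj1 Hr1)).
      pose proof (Rle_abs (- (p y - p (xb [-] INR (S k) [*] w)))) as H.
      rewrite Rabs_Ropp in H.
      rewrite !S_INR in *. rewrite !dfun_sub, !dfun_scal in *. lra.
Qed.

Lemma chain_sums_lower (X : Banach) (g : dual X -> ER) (x0s xs : dual X) (x0 : X) (a0 c : R) :
  proper g -> convex g -> weak_star_lsc g -> g x0s = Fin a0 -> subdiffX g x0s x0 ->
  lt_ER (Fin (a0 + c)) (g xs) -> exists v, chain_sums g x0s xs v /\ c < v.
Proof.
  intros Hproper Hconv Hlsc Ha0 Hx0 Hc.
  pose proof (subdiffX_conj_epi X g x0s x0 a0 Ha0 Hx0) as Hm0.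
  destruct (biconjugate X g x0 _ _ xs Hconv Hlsc Hm0 Hc) as (xb & M & HM & Hgap).
  set (e := xs xb - M - (a0 + c)) in *.
  assert (He : 0 < e) by (unfold e; lra).
  set (d := xb [-] x0).
  destruct (INR_unbounded (2 * Rabs (x0s d - xs d) / e)) as [n Hn].
  (* The backward chain stops at [x0 + w], so its first functional is evaluated one step further, at
     [x0], where the given pair [(x0s, x0)] is prepended. *)
  set (N := S n). set (w := / INR N [*] d).
  assert (HN0 : 0 < INR N) by (apply lt_0_INR; unfold N; lia).
  assert (Hw : forall f : dual X, INR N * f w = f xb - f x0).
  { intros f. unfold w, d. rewrite dfun_scal, dfun_sub. field. lra. }
  (* The two end steps leave the mismatch [x0s w - xs w]; it takes less than half of the gap [e],
     the other half being the error of [backward_chain]. *)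
  assert (Hsmall : Rabs (x0s w - xs w) < e / 2).
  { apply (Rmult_lt_reg_l (INR N)); [assumption|].
    rewrite <- (Rabs_pos_eq (INR N)) at 1 by lra. rewrite <- Rabs_mult.
    rewrite Rmult_minus_distr_l, !Hw, <- !dfun_sub. fold d.
    assert (Hn' : 2 * Rabs (x0s d - xs d) / e < INR N) by (unfold N; rewrite S_INR; lra).
    apply (Rmult_lt_compat_r (e / 2)) in Hn'; [|lra].
    replace (2 * Rabs (x0s d - xs d) / e * (e / 2)) with (Rabs (x0s d - xs d)) in Hn'
      by (field; lra).
    assumption. }
  assert (Hz : forall f : dual X, f (xb [-] INR n [*] w) = f x0 + f w).
  { intros f. rewrite dfun_sub, dfun_scal. specialize (Hw f). unfold N in Hw.
    rewrite S_INR in Hw. lra. }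
  assert (Hseg : conj_epi g (xb [-] INR n [*] w) (Rmax (x0s x0 - a0) M)).
  { apply (conj_epi_segment X g x0 xb w _ M N n); [assumption | assumption | assumption | |]; unfold N; lia. }
  destruct (is_conj_exists X g _ _ Hproper Hseg) as [r Hr].
  destruct (backward_chain X g xs x0 xb w _ M N n Hproper Hconv Hlsc Hm0 HM Hw
              ltac:(unfold N; lia) ltac:(unfold N; lia) r (e / 2) Hr)
    as (p & v & Hpv & Hle); [lra|].
  pose proof (proj1 Hr x0s a0 Ha0) as Hr0. rewrite Hz in Hr0.
  assert (Hp : p (xb [-] INR (S n) [*] w) = p x0).
  { rewrite dfun_sub, dfun_scal. fold N. rewrite Hw. ring. }
  rewrite Hp, dfun_sub in Hle. apply Rabs_def2 in Hsmall.
  exists (p x0 - x0s x0 + v). split.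
  - destruct Hpv as [[-> ->] | Hpv].
    + rewrite Rplus_0_r. now apply chain_sums_last.
    + now apply chain_sums_cons.
  - unfold e in *. lra.
Qed.

Theorem mainTheorem12 (X : Banach) (g : dual X -> ER)
  (Hproper : proper g) (Hconv : convex g) (Hlsc : weak_star_lsc g)
  (x0s xs : dual X)
  (Hx0 : exists x0 : X, subdiffX g x0s x0)
  (Hcase : (int_dom_nonempty g /\ in_dom g xs) \/ int_dom_conjX_nonempty g) :
  exists v : ER, is_sup_ER (chain_sums g x0s xs) v /\ g xs = add_ER (g x0s) v.
Proof.
  destruct Hx0 as [x0 Hx0]. pose proof Hx0 as (a0 & Ha0 & _).
  pose proof (fun c => chain_sums_lower X g x0s xs x0 a0 c Hproper Hconv Hlsc Ha0 Hx0) as Hlow.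
  (* When [g xs] is infinite, [Hlow] holds for every real [c], so the chain sums are unbounded. *)
  destruct (g xs) as [a|] eqn:Ha.
  - exists (Fin (a - a0)). split; [split|].
    + intros s Hs. exact (chain_sums_upper X g x0s xs a0 a s Ha0 Ha Hs).
    + intros c Hc. apply Hlow. simpl in *. lra.
    + rewrite Ha0. simpl. f_equal. ring.
  - exists PInf. split; [split|].
    + now intros.
    + intros c _. now apply Hlow.
    + now rewrite Ha0.
Qed.
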